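(* Let $G = (V,E)$ be a finite undirected graph with a total order on $V$, and let $\Sigma_G$ be its clique complex. Consider the following serial procedure, which builds layers $D(0), D(1), \dots$ of a directed tree whose nodes are simplices (subsets of $V$). Initialization: $D(0)$ consists of one node $\{v\}$ for each $v \in V$; $D(1)$ consists of one node $\{u,v\}$ for each edge $\{u,v\}\in E$, and each edge node is connected to the node of its smaller vertex. Inductive step (for $k \geq 1$, given layers $D(0),\dots,D(k)$ in which an element $\rho \in D(k-1)$ is connected to an element $\sigma \in D(k)$ iff $\rho$ is the lexicographically minimal $(k-1)$-face of $\sigma$): for each $\rho \in D(k-1)$, let $L_\rho \subset D(k)$ be the list of elements of $D(k)$ connected to $\rho$. For every pair $(\sigma_0 < \sigma_1)$ of distinct elements of $L_\rho$ (ordered lexicographically by their increasingly ordered vertex lists), let $v_i$ be the unique element of $(\sigma_0 \cup \sigma_1) \setminus \sigma_i$ for $i=0,1$, and check whether $\{v_0, v_1\} \in E$; if so, add $\tau := \sigma_0 \cup \sigma_1$ to $D(k+1)$ and connect $\sigma_0$ to $\tau$. This is repeated until a layer is empty. Consider also the parallel version of this procedure, in which the same edge checks are performed, independently and concurrently, with the construction of $D(k+1)$ from pairs in $L_\rho$ beginning as soon as two simplices in $D(k)$ sharing the common $(k-1)$-face $\rho$ are available. Then both the serial and the parallel procedures construct the clique complex of $G$: the set of all simplices appearing as nodes in the layers $D(0), D(1), \dots$ is exactly the set of simplices of $\Sigma_G$.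
   Context: The clique complex (Vietoris–Rips complex) $\Sigma_G$ of an undirected graph $G=(V,E)$ is the abstract simplicial complex whose simplices are the nonempty sets $\sigma=\{v_0,\dots,v_m\}\subset V$ such that $\{v_i,v_j\}\in E$ for all $i\neq j$; such a $\sigma$ is an $m$-simplex, and a $j$-face of a simplex is a subset with $j+1$ elements. Simplices of the same dimension are ordered lexicographically by their increasingly ordered vertex lists. *)

(* Defs.v *)
From Stdlib Require Import Relations.
From mathcomp Require Import all_boot all_order.

Set Implicit Arguments.
Unset Strict Implicit.
Unset Printing Implicit Defensive.

Import Order.TTheory.

Section CliqueComplexProcedures.

Context {d : Order.disp_t} {T : finOrderType d}.
Implicit Types (e : rel T) (rho sigma tau : {set T}) (k : nat).

Definition edges e : {set {set T}} :=
  [set [set p.1; p.2] | p : T * T & e p.1 p.2].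

Definition clique_complex e : {set {set T}} :=
  [set sigma | (sigma != set0) &&
     [forall u in sigma, forall v in sigma, (u != v) ==> e u v]].

Definition vertex_list sigma : seqlexi T := sort <=%O (enum sigma).

Definition lex_lt sigma tau : bool :=
  (vertex_list sigma < vertex_list tau :> seqlexi T)%O.

Definition lex_le sigma tau : bool :=
  (vertex_list sigma <= vertex_list tau :> seqlexi T)%O.

Definition is_face j sigma rho : bool :=
  (rho \subset sigma) && (#|rho| == j.+1).

Definition is_min_face j sigma rho : bool :=
  is_face j sigma rho && [forall rho', is_face j sigma rho' ==> lex_le rho rho'].

Definition arc : predArgType := ({set T} * {set T})%type.

(** [layer t k] is the layer $D(k)$; [arcs t] holds the pairs (parent, child). *)
Record tree := Tree { layer : nat -> {set {set T}}; arcs : {set arc} }.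

Definition init_tree e : tree :=
  Tree (fun k => match k with
                 | 0 => [set [set v] | v : T]
                 | 1 => edges e
                 | _ => set0
                 end)
       [set ([set p.1], [set p.1; p.2]) | p : T * T & (p.1 < p.2)%O && e p.1 p.2].

(** The list $L_\rho$ of elements of $D(k)$ connected to [rho]. *)
Definition children t k rho : {set {set T}} :=
  [set sigma in layer t k | (rho, sigma) \in arcs t].

(** The pairs $\sigma_0 < \sigma_1$ of elements of some $L_\rho$, with
    $\rho \in D(k-1)$; only used for $k \geq 1$. *)
Definition sibling_pairs t k : {set {set T} * {set T}} :=
  [set p | [exists rho in layer t k.-1,
     [&& p.1 \in children t k rho, p.2 \in children t k rho & lex_lt p.1 p.2]]].

(** [unset1 A] is [Some v] when [A] is the singleton of [v], else [None]. *)
Definition edge_check e (p : {set T} * {set T}) : bool :=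
  match unset1 ((p.1 :|: p.2) :\: p.1), unset1 ((p.1 :|: p.2) :\: p.2) with
  | Some v0, Some v1 => e v0 v1
  | _, _ => false
  end.

Definition run_check e k t (p : {set T} * {set T}) : tree :=
  if edge_check e p then
    let tau := p.1 :|: p.2 in
    Tree (fun j => if j == k.+1 then tau |: layer t j else layer t j)
         ((p.1, tau) |: arcs t)
  else t.

Record procedure := Procedure {
  state : Type;
  start : state;
  step : state -> state -> Prop;
  halted : state -> Prop;
  built : state -> tree
}.

Definition reachable (P : procedure) : state P -> Prop :=
  clos_refl_trans (state P) (@step P) (start P).

(** Total correctness: no deadlock, no infinite execution, correct result. *)
Definition constructs (P : procedure) (K : {set {set T}}) : Prop :=
  [/\ forall s : state P, reachable s -> ~ halted s -> exists s', step s s',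
      ~ (exists run : nat -> state P,
           run 0 = start P /\ forall n, step (run n) (run n.+1))
    & forall s : state P, reachable s -> halted s ->
        forall sigma, (exists k, sigma \in layer (built s) k) <-> sigma \in K].

Definition min_face_connected t k : Prop :=
  forall rho sigma, rho \in layer t k.-1 -> sigma \in layer t k ->
    ((rho, sigma) \in arcs t) = is_min_face k.-1 sigma rho.

(** In the state [(k, t)] the layers $D(0), \dots, D(k)$ have been built.  A
    step builds $D(k+1)$, running the checks one after the other, in any order.
    [min_face_connected], the standing assumption of the inductive step, guards
    the step: that it always holds is part of [constructs]. *)
Inductive serial_step e : nat * tree -> nat * tree -> Prop :=
  SerialStep k t ps of
      layer t k != set0
    & min_face_connected t k
    & perm_eq ps (enum (sibling_pairs t k)) :
    serial_step e (k, t) (k.+1, foldl (run_check e k) t ps).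

Definition serial e : procedure :=
  {| state := nat * tree;
     start := (1, init_tree e);
     step := serial_step e;
     halted := fun s => layer s.2 s.1 = set0;
     built := fun s => s.2 |}.

Definition check : eqType := (nat * ({set T} * {set T}))%type.

Record par_state := ParState {
  par_tree : tree;
  begun : seq check;
  running : seq check
}.

Definition startable (s : par_state) k p : Prop :=
  [/\ 0 < k, p \in sibling_pairs (par_tree s) k & (k, p) \notin begun s].

(** A check [(k, p)] may begin at any time once both simplices of [p] are
    available in $D(k)$ below a common parent, whether or not $D(k)$ is
    complete; any number of checks may be running at a time, and they finish in
    any order. *)
Inductive parallel_step e : par_state -> par_state -> Prop :=
| Begin s k p of startable s k p :
    parallel_step e s
      (ParState (par_tree s) ((k, p) :: begun s) ((k, p) :: running s))
| Finish s k p of (k, p) \in running s :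
    parallel_step e s
      (ParState (run_check e k (par_tree s) p) (begun s) (rem (k, p) (running s))).

Definition parallel e : procedure :=
  {| state := par_state;
     start := ParState (init_tree e) [::] [::];
     step := parallel_step e;
     halted := fun s => running s = [::] /\ forall k p, ~ startable s k p;
     built := par_tree |}.

End CliqueComplexProcedures.

(* Main.v *)
(** Every simplex [sigma] with at least two vertices has a unique parent, its
    lexicographically minimal face, which is [sigma] without its largest vertex.
    If [b] and [a] are the two largest vertices of a clique [tau] with at least
    three vertices, then [tau :\ b] and [tau :\ a] are siblings below
    [tau :\ b :\ a], and the check of this pair adds [tau].  Conversely, a
    successful check of two siblings adds a clique, and connects it to its
    minimal face.  So it is invariant, in whatever order the checks are done,
    that all nodes are cliques connected to their parents, and, by induction on
    the dimension, no clique is missing once there is no check left. *)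
Require Import Defs.
From Stdlib Require Import Relations.
From mathcomp Require Import all_boot all_order.

Set Implicit Arguments.
Unset Strict Implicit.
Unset Printing Implicit Defensive.

Import Order.TTheory.

(** * Total correctness from an invariant and a measure *)

Lemma constructs_by_invariant (d : Order.disp_t) (T : finOrderType d)
    (P : @procedure d T) (K : {set {set T}})
    (I : state P -> Prop) (m : state P -> nat) :
    I (start P) ->
    (forall s s', I s -> step s s' -> I s' /\ m s' < m s) ->
    (forall s, I s -> ~ halted s -> exists s', step s s') ->
    (forall s, I s -> halted s ->
       forall sigma, (exists k, sigma \in layer (built s) k) <-> sigma \in K) ->
  constructs P K.
Proof.
move=> I0 Istep Iprogress Ihalted.
have Ireach s : reachable s -> I s.
  rewrite /reachable => /(clos_rt_rtn1 _ _ _ _).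
  by elim=> [//|s1 s2 s12 _ Is1]; case: (Istep _ _ Is1 s12).
split=> [s /Ireach /Iprogress //| [run [run0 runS]] | s /Ireach /Ihalted //].
have Irun n : I (run n).
  by elim: n => [|n In]; [rewrite run0 | case: (Istep _ _ In (runS n))].
(* Each step costs at least one unit of measure, so a run has at most [m (run 0)] steps. *)
have bound n : m (run n) + n <= m (run 0).
  elim: n => [|n]; first by rewrite addn0.
  apply: leq_trans; rewrite addnS -addSn leq_add2r.
  by case: (Istep _ _ (Irun n) (runS n)).
by have := leq_trans (leq_addl _ _) (bound (m (run 0)).+1); rewrite ltnn.
Qed.

(** * Lexicographic order on sequences *)

Section Lexicographic.

Context {d : Order.disp_t} {T : orderType d}.
Implicit Types (s : seq T) (a b : T).

Lemma lexi_rcons s a b :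
  ((rcons s a : seqlexi T) < (rcons s b : seqlexi T))%O = (a < b)%O.
Proof.
elim: s => [|y s IHs] /=; rewrite ltxi_cons.
  by rewrite ltxx implybF -ltNge andb_idl // => /ltW.
by rewrite lexx IHs.
Qed.

(** Where [s'] first departs from the prefix it skips an entry of [s], hence continues with a larger
    one, as [s] increases strictly. *)
Lemma lexi_take_subseq s s' :
  sorted <%O s -> subseq s' s -> ((take (size s') s : seqlexi T) <= s')%O.
Proof.
elim: s s' => [|y s IHs] [|z s'] //= path_ys.
rewrite lexi_cons; case: eqVneq => [-> sub_s's | _ sub_zs's].
  by rewrite lexx IHs ?(path_sorted path_ys).
have lt_yz : (y < z)%O.
  apply: (allP (order_path_min lt_trans path_ys)).
  by apply: (mem_subseq sub_zs's); rewrite mem_head.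
by rewrite (ltW lt_yz) leNgt lt_yz.
Qed.

End Lexicographic.

(** * Vertex lists and minimal faces *)

Section VertexLists.

Context {d : Order.disp_t} {T : finOrderType d}.
Implicit Types (rho sigma tau : {set T}) (x a b : T) (k : nat).

Lemma mem_vertex_list sigma x : (x \in (vertex_list sigma : seq T)) = (x \in sigma).
Proof. by rewrite mem_sort mem_enum. Qed.

Lemma size_vertex_list sigma : size (vertex_list sigma : seq T) = #|sigma|.
Proof. by rewrite size_sort -cardE. Qed.

Lemma vertex_list_sorted sigma : sorted <%O (vertex_list sigma : seq T).
Proof.
by rewrite lt_sorted_uniq_le sort_uniq enum_uniq sort_sorted //; apply: le_total.
Qed.

Lemma vertex_list_eq sigma (s : seq T) :
  sorted <%O s -> s =i sigma -> (vertex_list sigma : seq T) = s.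
Proof.
move=> sorted_s s_sigma; apply: lt_sorted_eq => // [|x].
  exact: vertex_list_sorted.
by rewrite mem_vertex_list s_sigma.
Qed.

Lemma vertex_list_inj : injective (@vertex_list d T).
Proof.
by move=> rho sigma eq_l; apply/setP=> x; rewrite -!mem_vertex_list eq_l.
Qed.

Lemma vertex_list_subseq rho sigma :
  rho \subset sigma -> subseq (vertex_list rho) (vertex_list sigma).
Proof.
move=> /subsetP sub; rewrite (@vertex_list_eq rho [seq x <- vertex_list sigma | x \in rho]).
- exact: filter_subseq.
- exact: (sorted_filter lt_trans _ (vertex_list_sorted sigma)).
- by move=> x; rewrite mem_filter mem_vertex_list andb_idr // => /sub.
Qed.

(** The minimal face relation, free of dimensions and lexicographic comparison; [min_faceP] links
    the two forms. *)
Definition parent rho sigma : Prop :=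
  exists2 x, {in rho, forall y, (y < x)%O} & sigma = x |: rho.

Lemma notin_below rho x : {in rho, forall y, (y < x)%O} -> x \notin rho.
Proof. by move=> below; apply/negP=> /below; rewrite ltxx. Qed.

Lemma vertex_list_setU1 rho x : {in rho, forall y, (y < x)%O} ->
  (vertex_list (x |: rho) : seq T) = rcons (vertex_list rho) x.
Proof.
move=> below; apply: vertex_list_eq => [|y]; last first.
  by rewrite mem_rcons !inE mem_vertex_list.
rewrite lt_sorted_pairwise pairwise_rcons -lt_sorted_pairwise vertex_list_sorted andbT.
by apply/allP=> y; rewrite mem_vertex_list => /below.
Qed.

(** The two vertex lists differ only in their last entries. *)
Lemma lex_lt_setU1 rho a b :
    {in rho, forall y, (y < a)%O} -> {in rho, forall y, (y < b)%O} ->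
  lex_lt (a |: rho) (b |: rho) = (a < b)%O.
Proof.
by move=> below_a below_b; rewrite /lex_lt !vertex_list_setU1 // lexi_rcons.
Qed.

Lemma parent_card rho sigma : parent rho sigma -> #|sigma| = #|rho|.+1.
Proof. by case=> x below ->; rewrite cardsU1 notin_below. Qed.

Lemma exists_max_vertex sigma : sigma != set0 ->
  exists2 x, x \in sigma & {in sigma :\ x, forall y, (y < x)%O}.
Proof.
case/set0Pn=> x0 x0s.
case: (@arg_maxP _ T T x0 (mem sigma) id x0s) => x /= xs x_max.
exists x => // y; rewrite !inE => /andP[y_neq_x ys].
by rewrite lt_neqAle y_neq_x x_max.
Qed.

(** In both decompositions the added vertex is the maximum of [sigma]. *)
Lemma parent_unique rho rho' sigma :
  parent rho sigma -> parent rho' sigma -> rho = rho'.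
Proof.
case=> x below -> [y below' eq_s].
have eq_xy : x = y.
  have: x \in y |: rho' by rewrite -eq_s setU11.
  have: y \in x |: rho by rewrite eq_s setU11.
  rewrite !inE => /predU1P[-> //|/below lt_yx] /predU1P[//|/below'].
  by move/lt_trans/(_ lt_yx); rewrite ltxx.
by rewrite -(setU1K (notin_below below)) eq_s eq_xy setU1K ?notin_below.
Qed.

(** The list of [rho] is a prefix of that of [sigma], and a prefix is least among the subsequences
    of its length. *)
Lemma parent_min_face rho sigma k :
  #|sigma| = k.+2 -> parent rho sigma -> is_min_face k sigma rho.
Proof.
move=> card_s par; have card_rho : #|rho| = k.+1.
  by apply: succn_inj; rewrite -(parent_card par).
case: par => x below def_s; rewrite /is_min_face /is_face def_s subsetUr card_rho eqxx.
apply/forallP=> rho'; apply/implyP=> /andP[/vertex_list_subseq sub /eqP card_rho'].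
have := lexi_take_subseq (vertex_list_sorted _) sub.
by rewrite vertex_list_setU1 // -cats1 take_size_cat // !size_vertex_list card_rho'.
Qed.

Lemma min_faceP rho sigma k : #|sigma| = k.+2 ->
  is_min_face k sigma rho <-> parent rho sigma.
Proof.
move=> card_s; split=> [|]; last exact: parent_min_face.
have [x xs below] : exists2 x, x \in sigma & {in sigma :\ x, forall y, (y < x)%O}.
  by apply: exists_max_vertex; rewrite -card_gt0 card_s.
have par : parent (sigma :\ x) sigma by exists x; rewrite ?setD1K.
case/andP: (parent_min_face card_s par) => face' /forallP min'.
case/andP=> face /forallP min.
(* Two minimal faces are lexicographically below each other, and a vertex list determines its
   set. *)
suff -> : rho = sigma :\ x by [].
apply: vertex_list_inj; apply/eqP; rewrite eq_le.
by apply/andP; split; [apply: (implyP (min _)) | apply: (implyP (min' _))].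
Qed.

End VertexLists.

(** * Cliques of the graph and their unions *)

Section Trees.

Context {d : Order.disp_t} {T : finOrderType d}.
Variable e : rel T.
Hypotheses (e_sym : symmetric e) (e_irr : irreflexive e).
Implicit Types (rho sigma tau : {set T}) (x a b u v : T) (j k : nat).
Implicit Types (t : @tree d T) (p : {set T} * {set T}).

Lemma cliqueP sigma :
  reflect (sigma != set0 /\ {in sigma &, forall u v, u != v -> e u v})
          (sigma \in clique_complex e).
Proof.
rewrite inE; apply: (iffP andP) => -[ne0 cl]; split=> //.
  by move=> u v us vs; move/forall_inP/(_ u us)/forall_inP/(_ v vs)/implyP: cl.
apply/forall_inP=> u us; apply/forall_inP=> v vs; apply/implyP; exact: cl.
Qed.

Lemma clique_sub rho sigma : rho != set0 -> rho \subset sigma ->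
  sigma \in clique_complex e -> rho \in clique_complex e.
Proof.
move=> ne0 /subsetP sub /cliqueP[_ cl]; apply/cliqueP; split=> // u v us vs.
by apply: cl; apply: sub.
Qed.

Lemma setU1_neq0 x rho : x |: rho != set0.
Proof. by apply/set0Pn; exists x; rewrite setU11. Qed.

Lemma setU1U rho a b : (a |: rho) :|: (b |: rho) = b |: (a |: rho).
Proof. by rewrite setUCA -setUA setUid. Qed.

(** Every pair of vertices of the union other than [a], [b] lies within one of the two cliques. *)
Lemma clique_setU2 rho a b :
    a |: rho \in clique_complex e -> b |: rho \in clique_complex e -> e a b ->
  (a |: rho) :|: (b |: rho) \in clique_complex e.
Proof.
case/cliqueP=> _ cla /cliqueP[_ clb] e_ab; apply/cliqueP; split.
  by apply/set0Pn; exists a; rewrite !inE eqxx.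
move=> u v; rewrite !inE -!orbA.
case/or4P=> [/eqP->|ur|/eqP->|ur]; case/or4P=> [/eqP->|vr|/eqP->|vr] u_neq_v;
  try (by rewrite // eqxx in u_neq_v);
  by [ rewrite // e_sym | apply: cla; rewrite // !inE ?eqxx ?ur ?vr ?orbT
     | apply: clb; rewrite // !inE ?eqxx ?ur ?vr ?orbT ].
Qed.

(** * Invariants of the growing tree *)

(** Meant for every intermediate tree, even in the middle of a layer: from dimension 2 on it does
    not say which cliques are present. *)
Record sound t : Prop := Sound {
  sound_layer : forall j sigma, sigma \in layer t j ->
    sigma \in clique_complex e /\ #|sigma| = j.+1;
  sound_arc : forall rho sigma, (rho, sigma) \in arcs t -> parent rho sigma;
  sound_parent : forall j sigma, sigma \in layer t j.+1 ->
    exists2 rho, rho \in layer t j & (rho, sigma) \in arcs t;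
  sound_vertex : forall v, [set v] \in layer t 0;
  sound_edge : forall u v, e u v -> [set u; v] \in layer t 1
}.

Definition complete_at t j : Prop :=
  forall sigma, sigma \in clique_complex e -> #|sigma| = j.+1 -> sigma \in layer t j.

(** [sound_parent] provides an arc from some parent, and parents are unique. *)
Lemma sound_arcP t j rho sigma : sound t -> sigma \in layer t j.+1 ->
  (rho, sigma) \in arcs t <-> parent rho sigma.
Proof.
move=> snd sl; split=> [|par]; first exact: sound_arc.
case: (sound_parent snd sl) => rho' _ arc'.
by rewrite (parent_unique par (sound_arc snd arc')).
Qed.

Lemma sound_init : sound (init_tree e).
Proof.
(* Symmetry lets the smaller endpoint come first; irreflexivity excludes loops, which would yield
   singletons in [D(1)]. *)
have edgeP sigma : sigma \in edges e ->
    exists u v, [/\ (u < v)%O, e u v & sigma = [set u; v]].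
  case/imsetP=> -[u v]; rewrite inE /= => e_uv ->.
  case: (ltgtP u v) => [lt_uv|lt_vu|eq_uv]; first by exists u, v.
    by exists v, u; rewrite setUC e_sym.
  by rewrite eq_uv e_irr in e_uv.
split=> [[|[|j]] sigma /=|rho sigma /=|[|j] sigma /=|v|u v e_uv] //=.
- case/imsetP=> v _ ->; rewrite cards1; split=> //; apply/cliqueP; split.
    by apply/set0Pn; exists v; rewrite set11.
  by move=> x y /set1P-> /set1P->; rewrite eqxx.
- case/edgeP=> u [v [lt_uv e_uv ->]]; rewrite cards2 lt_eqF //; split=> //.
  apply/cliqueP; split; first exact: setU1_neq0.
  by move=> x y /set2P[]-> /set2P[]->; rewrite ?eqxx // e_sym.
- by rewrite inE.
- case/imsetP=> -[u v]; rewrite inE /= => /andP[lt_uv _] [-> ->].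
  by exists v; [move=> y /set1P-> | rewrite setUC].
- case/edgeP=> u [v [lt_uv e_uv ->]]; exists [set u]; first exact: imset_f.
  by apply/imsetP; exists (u, v); rewrite // inE lt_uv.
- by rewrite inE.
- exact: imset_f.
- by apply/imsetP; exists (u, v); rewrite // inE.
Qed.

Lemma sound_complete0 t : sound t -> complete_at t 0.
Proof. by move=> snd sigma _ /eqP/cards1P[v ->]; apply: sound_vertex. Qed.

Lemma sound_complete1 t : sound t -> complete_at t 1.
Proof.
move=> snd sigma /cliqueP[_ cl] /eqP/cards2P[u [v [u_neq_v def_s]]].
by rewrite def_s; apply: (sound_edge snd); apply: cl; rewrite ?def_s ?set21 ?set22.
Qed.

(** * Sibling pairs and edge checks *)

(** The arguments of [e] come out swapped because the vertex missing from the first simplex is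
    [b]. *)
Lemma edge_check_setU1 rho a b : a \notin rho -> b \notin rho -> a != b ->
  edge_check e (a |: rho, b |: rho) = e b a.
Proof.
move=> a_rho b_rho a_neq_b; rewrite /edge_check /=.
have diff x y : y \notin rho -> x != y ->
    ((x |: rho) :|: (y |: rho)) :\: (x |: rho) = [set y].
  move=> y_rho x_neq_y; apply/setP=> z; rewrite !inE.
  have [->|] := eqVneq z y; first by rewrite eq_sym (negPf x_neq_y) (negPf y_rho).
  by case: (z == x); case: (z \in rho).
by rewrite diff // setUC diff 1?eq_sym // !set1K.
Qed.

Lemma sibling_pairsP t k p : sound t ->
    p \in sibling_pairs t k.+1 ->
  exists rho a b, [/\ {in rho, forall y, (y < a)%O}, (a < b)%O,
    p = (a |: rho, b |: rho), a |: rho \in layer t k.+1 & b |: rho \in layer t k.+1].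
Proof.
move=> snd; rewrite inE; case: p => s0 s1 /exists_inP[rho _ /= /and3P[]].
rewrite !inE => /andP[l0 /(sound_arc snd)[a below_a def0]].
case/andP=> l1 /(sound_arc snd)[b below_b def1]; rewrite {}def0 {}def1 in l0 l1 *.
by rewrite lex_lt_setU1 // => lt_ab; exists rho, a, b.
Qed.

(** Layer [k.+1] supplies the two siblings and layer [k] their common parent. *)
Lemma complete_sibling_pair t k tau : sound t ->
    complete_at t k -> complete_at t k.+1 ->
    tau \in clique_complex e -> #|tau| = k.+3 ->
  exists2 p, p \in sibling_pairs t k.+1 & edge_check e p && (p.1 :|: p.2 == tau).
Proof.
move=> snd cplk cplk1 cl card_tau.
have [b b_tau below_b] : exists2 x, x \in tau & {in tau :\ x, forall y, (y < x)%O}.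
  by apply: exists_max_vertex; rewrite -card_gt0 card_tau.
pose s0 := tau :\ b; have card_s0 : #|s0| = k.+2.
  by have := cardsD1 b tau; rewrite b_tau card_tau => -[].
have [a a_s0 below_a] : exists2 x, x \in s0 & {in s0 :\ x, forall y, (y < x)%O}.
  by apply: exists_max_vertex; rewrite -card_gt0 card_s0.
pose rho := s0 :\ a; have card_rho : #|rho| = k.+1.
  by have := cardsD1 a s0; rewrite a_s0 card_s0 => -[].
have lt_ab : (a < b)%O by apply: below_b.
have below_b' : {in rho, forall y, (y < b)%O}.
  by move=> y; rewrite inE => /andP[_]; apply: below_b.
have def_s0 : s0 = a |: rho by rewrite setD1K.
have def_tau : tau = b |: (a |: rho) by rewrite -def_s0 setD1K.
have tau_u : (a |: rho) :|: (b |: rho) = tau by rewrite setU1U def_tau.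
have l0 : a |: rho \in layer t k.+1.
  apply: cplk1; last by rewrite -def_s0.
  by apply: clique_sub cl; rewrite ?setU1_neq0 // -tau_u subsetUl.
have l1 : b |: rho \in layer t k.+1.
  apply: cplk1; last by rewrite cardsU1 notin_below ?card_rho.
  by apply: clique_sub cl; rewrite ?setU1_neq0 // -tau_u subsetUr.
have lr : rho \in layer t k.
  apply: cplk => //; apply: clique_sub cl; first by rewrite -card_gt0 card_rho.
  by apply: subset_trans (subsetUr [set a] rho) _; rewrite -tau_u subsetUl.
exists (a |: rho, b |: rho).
  rewrite inE; apply/exists_inP; exists rho => //.
  (* In a sound tree these nodes are linked to their parents, so both arcs from [rho] are
     present. *)
  rewrite 2!inE /= l0 l1 lex_lt_setU1 // lt_ab andbT.
  by apply/andP; split; [apply/(sound_arcP rho snd l0); exists a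
                        | apply/(sound_arcP rho snd l1); exists b].
rewrite tau_u eqxx andbT edge_check_setU1 ?notin_below ?lt_eqF //.
by case/cliqueP: cl => _; apply; rewrite ?gt_eqF // def_tau !inE eqxx ?orbT.
Qed.

(** * Effect of running checks *)

(** Checks only add nodes and arcs, so an available sibling pair stays available. *)
Definition subtree t t' : Prop :=
  (forall j, layer t j \subset layer t' j) /\ arcs t \subset arcs t'.

Lemma subtree_sibling_pairs t t' k : subtree t t' ->
  sibling_pairs t k \subset sibling_pairs t' k.
Proof.
case=> subl /subsetP suba; apply/subsetP=> p; rewrite !inE.
case/exists_inP=> rho rl /and3P[]; rewrite !inE => /andP[l0 a0] /andP[l1 a1] lt.
apply/exists_inP; exists rho; first exact: (subsetP (subl _)).
by rewrite !inE lt !suba // !(subsetP (subl _)).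
Qed.

Lemma run_check_subtree k t p : subtree t (run_check e k t p).
Proof.
rewrite /run_check; case: ifP => _; split=> //= [j|]; last exact: subsetUr.
by case: ifP => // _; apply: subsetUr.
Qed.

Lemma run_check_done k t p :
  edge_check e p -> p.1 :|: p.2 \in layer (run_check e k t p) k.+1.
Proof. by rewrite /run_check => -> /=; rewrite eqxx setU11. Qed.

Lemma sound_run_check k t p : sound t -> p \in sibling_pairs t k.+1 ->
  sound (run_check e k.+1 t p).
Proof.
move=> snd sib; rewrite /run_check; case: ifPn => // chk.
have [rho [a [b [below_a lt_ab def_p l0 l1]]]] := sibling_pairsP snd sib.
have below_b : {in rho, forall y, (y < b)%O}.
  by move=> y /below_a/lt_trans; apply.
move: chk; rewrite {}def_p /= edge_check_setU1 ?notin_below ?lt_eqF // => e_ba.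
set tau := _ :|: _.
(* As [b] is the largest vertex, the parent of [tau] is the first sibling, from which the new arc
   starts. *)
have par : parent (a |: rho) tau.
  exists b; first by move=> y /setU1P[->|/below_b].
  exact: setU1U.
have [cl0 card0] := sound_layer snd l0; have [cl1 _] := sound_layer snd l1.
have cl_tau : tau \in clique_complex e by rewrite clique_setU2 // e_sym.
split=> [j sigma /=|r s /=|j sigma /=|v|u v e_uv].
- case: eqP => [->|_]; last exact: sound_layer.
  case/setU1P=> [->|]; last exact: sound_layer.
  by rewrite (parent_card par) card0.
- by case/setU1P=> [[-> ->] //|]; apply: sound_arc.
- have old : sigma \in layer t j.+1 -> exists2 r,
      r \in (if j == k.+2 then tau |: layer t j else layer t j) &
      (r, sigma) \in (a |: rho, tau) |: arcs t.
    case/(sound_parent snd)=> r rl ra; exists r; last by rewrite inE ra orbT.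
    by case: ifP => // _; rewrite inE rl orbT.
  case: (eqVneq j.+1) => // -[def_j] /setU1P[->|//].
  exists (a |: rho); last exact: setU11.
  by rewrite def_j; case: ifP => // _; rewrite inE l0 orbT.
- exact: (sound_vertex snd).
- exact: (sound_edge snd).
Qed.

(** Discharges the guard of [serial_step], so the serial procedure cannot get stuck on it. *)
Lemma sound_min_face_connected k t : sound t -> min_face_connected t k.+1.
Proof.
move=> snd rho sigma _ sl; have [_ card_s] := sound_layer snd sl.
apply/idP/idP => [/(sound_arcP rho snd sl)/(min_faceP rho card_s) //|].
by move/(min_faceP rho card_s)/(sound_arcP rho snd sl).
Qed.

(** Earlier checks keep the later pairs available, and later checks keep the nodes already added. *)
Lemma foldl_run_check k t ps : sound t ->
    {subset ps <= sibling_pairs t k.+1} ->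
  let t' := foldl (run_check e k.+1) t ps in
  [/\ sound t', forall j, layer t j \subset layer t' j &
      {in ps, forall p, edge_check e p -> p.1 :|: p.2 \in layer t' k.+2}].
Proof.
elim: ps t => [|p ps IHps] t snd sub //=.
have sibp : p \in sibling_pairs t k.+1 by apply: sub; rewrite mem_head.
have subt := run_check_subtree k.+1 t p.
have [||snd' sub' done'] := IHps (run_check e k.+1 t p).
- exact: sound_run_check.
- move=> q qps; apply: (subsetP (subtree_sibling_pairs _ subt)).
  by apply: sub; rewrite inE qps orbT.
split=> // [j|q /predU1P[->|/done' //] chk].
  exact: subset_trans (subt.1 j) (sub' j).
by apply: (subsetP (sub' _)); apply: run_check_done.
Qed.

(** * The serial procedure *)

Lemma serial_constructs : constructs (serial e) (clique_complex e).
Proof.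
pose I (s : nat * @tree d T) :=
  [/\ 0 < s.1, sound s.2 & forall j, j <= s.1 -> complete_at s.2 j].
apply: (@constructs_by_invariant _ _ (serial e) _ I (fun s => #|T| - s.1)).
- split=> //=; first exact: sound_init.
  by move=> [|[|//]] _; [apply: sound_complete0 | apply: sound_complete1];
     apply: sound_init.
- move=> s s' Is step; case: step Is => {s s'} k t ps ne0 _ perm [/= k_gt0 snd cpl].
  case: k k_gt0 ne0 perm cpl => [//|k] _ ne0 perm cpl.
  have [|snd' sub done'] := @foldl_run_check k t ps snd.
    by move=> p; rewrite (perm_mem perm) mem_enum.
  split; last first.
    (* A node of the current layer has one vertex more than the index of the layer, so this index is
       below [#|T|] and the truncated difference really decreases. *)
    have [sigma /(sound_layer snd)[_ card_s]] := set0Pn _ ne0.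
    by have := max_card (mem sigma); rewrite card_s => lt_kT; rewrite subnS prednK ?subn_gt0.
  split=> //= j; rewrite leq_eqVlt => /predU1P[->|le_jk] sigma cl card_s; last first.
    by apply: (subsetP (sub _)); apply: cpl.
  have [||p sib /andP[chk /eqP<-]] := complete_sibling_pair snd _ _ cl card_s.
  + exact: cpl.
  + exact: cpl.
  by apply: done' chk; rewrite (perm_mem perm) mem_enum.
- move=> [[|k] t] [//= _ snd _] /eqP ne0.
  exists (k.+2, foldl (run_check e k.+1) t (enum (sibling_pairs t k.+1))).
  exact: SerialStep ne0 (sound_min_face_connected snd) (perm_refl _).
- move=> [k t] [/= _ snd cpl] /= halt sigma; split=> [[j /(sound_layer snd)[]//]|cl].
  have ne0 : 0 < #|sigma| by rewrite card_gt0; case/cliqueP: cl.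
  have [le_sk|lt_ks] := leqP #|sigma|.-1 k.
    by exists #|sigma|.-1; apply: cpl; rewrite ?prednK.
  (* A clique of dimension above [k] would contain one with [k.+1] vertices, a node of the empty
     layer [k]. *)
  have : k.+1 <= #|sigma| by rewrite -(prednK ne0) ltnW.
  case/card_geqP=> s [s_uniq size_s sub_s].
  have card_s : #|[set x in s]| = k.+1 by rewrite cardsE (card_uniqP s_uniq).
  suff: [set x in s] \in layer t k by rewrite halt inE.
  apply: cpl => //; apply: clique_sub cl; first by rewrite -card_gt0 card_s.
  by apply/subsetP=> x; rewrite inE => /sub_s.
Qed.

(** * The parallel procedure *)

(** The last clause carries completeness: a successful check, once begun, is still running or has
    left its node in the tree. Uniqueness of [begun] serves to bound the number of checks. *)
Definition sound_par (s : @par_state d T) : Prop :=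
  [/\ sound (par_tree s), uniq (begun s),
      {subset running s <= begun s},
      forall k p, (k, p) \in begun s -> 0 < k /\ p \in sibling_pairs (par_tree s) k
    & forall k p, (k, p) \in begun s -> edge_check e p ->
        (k, p) \in running s \/ p.1 :|: p.2 \in layer (par_tree s) k.+1].

(** Layers are indexed by all natural numbers; this bound leaves only finitely many possible
    checks. *)
Lemma sibling_pairs_bound t k p :
  sound t -> 0 < k -> p \in sibling_pairs t k -> k < #|T|.
Proof.
case: k => [//|k] snd _ /(sibling_pairsP snd)[rho [a [b [_ _ _]]]].
by case/(sound_layer snd)=> _ <- _; apply: max_card.
Qed.

Lemma sound_par_size s : sound_par s ->
  size (begun s) <= #|{: 'I_#|T| * ({set T} * {set T})}|.
Proof.
case=> snd uniq_b _ sib _.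
pose f (c : 'I_#|T| * ({set T} * {set T})) : check := (val c.1, c.2).
rewrite cardE -(size_map f); apply: uniq_leq_size => // -[k p] /sib[k_gt0 sibp].
apply/mapP; exists (Ordinal (sibling_pairs_bound snd k_gt0 sibp), p) => //.
by rewrite mem_enum.
Qed.

Lemma parallel_constructs : constructs (parallel e) (clique_complex e).
Proof.
pose N := #|{: 'I_#|T| * ({set T} * {set T})}|.
(* Beginning a check lowers the doubled term by 2 and adds 1 running check; finishing one removes a
   running check. Either way the sum drops by 1. *)
apply: (@constructs_by_invariant _ _ (parallel e) _ sound_par
          (fun s => (N - size (begun s)).*2 + size (running s))).
- by split=> //=; apply: sound_init.
- move=> s s' Is step.
  suff Is' : sound_par s'.
    (* The bound at the new state keeps the subtraction from truncating. *)
    split=> //; have {Is'} := sound_par_size Is'.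
    case: step Is => {s s'} [s k p _ _ /= bound|s k p run _ _ /=].
      by rewrite -(subnSK bound) doubleS addnS.
    by rewrite ltn_add2l size_rem // prednK //; case: (running s) run.
  case: step Is => {s s'} s k p => [[k_gt0 sib new]|run].
    case=> snd uniq_b sub sibs fin; split=> //=.
    + by rewrite new.
    + by move=> c /predU1P[->|/sub cb]; rewrite inE ?eqxx ?cb ?orbT.
    + by move=> k' p' /predU1P[[-> ->]|/sibs].
    move=> k' p' /predU1P[[-> ->]|cb chk]; first by left; rewrite mem_head.
    by case: (fin _ _ cb chk) => [H|]; [left; rewrite inE H orbT | right].
  case=> snd uniq_b sub sibs fin.
  have [k_gt0 sib] := sibs _ _ (sub _ run).
  have subt := run_check_subtree k (par_tree s) p.
  split=> //=.
  + by case: k k_gt0 sib {run subt} => // k _; apply: sound_run_check.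
  + by move=> c /mem_rem/sub.
  + move=> k' p' /sibs[k'_gt0 sib']; split=> //.
    exact: (subsetP (subtree_sibling_pairs _ subt)).
  move=> k' p' cb chk; have [[eq_k eq_p]|neq] := eqVneq (k', p') (k, p).
    by right; rewrite eq_k eq_p in chk *; apply: run_check_done.
  case: (fin _ _ cb chk) => [H|H]; [left | right; exact: (subsetP (subt.1 _))].
  exact: rem_mem.
- move=> s [snd _ _ _ _] /= nhalt.
  case def_r: (running s) => [|[k p] r]; last first.
    by eexists; apply: (@Finish _ _ e s k p); rewrite def_r mem_head.
  (* The index [k] of a startable check is a priori unbounded; the bound by [#|T|] confines the
     search to a finite type. *)
  pose A := [pred c : 'I_#|T| * ({set T} * {set T}) |
    [&& 0 < c.1, c.2 \in sibling_pairs (par_tree s) c.1 & (val c.1, c.2) \notin begun s]].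
  case: (pickP A) => [[k p] /and3P[k_gt0 sib new]|none].
    by eexists; apply: (@Begin _ _ _ _ (val k) p).
  case: nhalt; split=> // k p [k_gt0 sib new].
  have := none (Ordinal (sibling_pairs_bound snd k_gt0 sib), p).
  by rewrite /A /= k_gt0 sib new.
- move=> s [snd _ sub sibs fin] /= [run0 nstart] sigma.
  split=> [[j /(sound_layer snd)[]//]|cl].
  (* Two consecutive layers at once, since completing a layer uses the two before it. *)
  suff cpl j : complete_at (par_tree s) j /\ complete_at (par_tree s) j.+1.
    exists #|sigma|.-1; apply: (cpl _).1 => //.
    by rewrite prednK // card_gt0; case/cliqueP: cl.
  elim: j => [|j [cplj cplj1]].
    by split; [apply: sound_complete0 | apply: sound_complete1].
  split=> // tau cl_tau card_tau.
  have [p sib /andP[chk /eqP<-]] := complete_sibling_pair snd cplj cplj1 cl_tau card_tau.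
  (* A check not begun would be startable, against the halt; a begun one no longer runs, so its node
     is present. *)
  have [cb|new] := boolP ((j.+1, p) \in begun s); last by case: (nstart j.+1 p).
  by case: (fin _ _ cb chk) => //; rewrite run0.
Qed.

End Trees.

Theorem theorem3p3 (d : Order.disp_t) (T : finOrderType d) (e : rel T)
    (e_sym : symmetric e) (e_irr : irreflexive e) :
  constructs (serial e) (clique_complex e) /\
  constructs (parallel e) (clique_complex e).
Proof. by split; [apply: serial_constructs | apply: parallel_constructs]. Qed.
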